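(* Let $X\subset\mathbb{R}^d$ be a finite set, $\mathcal H=\mathbb{R}^X$ with Euclidean norm $\|\cdot\|_{\mathcal H}$, and let $Q_1,\dots,Q_n:\mathcal H\to\mathcal H$ be deterministic linear quasi-interpolation operators, with multiscale approximation operators $M_j$ and multiscale error operators $E_j$. Let $f\in\mathcal H$, $Y=f+\varepsilon$ with $\varepsilon$ a random element of $\mathcal H$ satisfying $\mathbb{E}[\varepsilon]=0$, and $\widetilde f_n=M_nY$. Suppose that, for some nonnegative numbers $\eta_1,\dots,\eta_n$, $$\|E_if\|_{\mathcal H}\le\eta_i\,\|E_{i-1}f\|_{\mathcal H},\qquad i=1,\dots,n .$$ Then $$\|f-\mathbb{E}[\widetilde f_n]\|_{\mathcal H}\le\Bigl(\prod_{i=1}^n\eta_i\Bigr)\|f\|_{\mathcal H}.$$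
   Context: The data sites $X$ and a nested hierarchy $X_1\subset\cdots\subset X_n=X$ are fixed; $\mathbb{E}$ is the expectation with respect to the noise $\varepsilon$ only. The level-$i$ quasi-interpolation operator $Q_i:\mathcal H\to\mathcal H$ restricts the values of a function on $X$ to $X_i$, forms the level-$i$ quasi-interpolant from them, and re-evaluates it on all of $X$; the only structural property assumed is that $Q_i$ is deterministic and linear. Multiscale recursion: $M_0=0$, $E_0=I$, and for $i=1,\dots,n$: $M_if=M_{i-1}f+Q_iE_{i-1}f$, $E_if=E_{i-1}f-Q_iE_{i-1}f$. *)

(* Defs.v *)
From HB Require Import structures.
From mathcomp Require Export all_boot all_order all_algebra.
From mathcomp Require Export finmap.
From mathcomp Require Export all_classical all_reals all_analysis.

Set Implicit Arguments.
Unset Strict Implicit.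
Unset Printing Implicit Defensive.

Local Open Scope ring_scope.

(* Real-valued functions on the finite set X, i.e. R^X. The codomain is R^o
   (the ring R viewed as a module over itself) so that R^X is an R-module. *)
Notation fun_on X R := {ffun X -> R^o}.

Definition euclid_norm (R : realType) (I : finType) (g : fun_on I R) : R :=
  Num.sqrt (\sum_(x : I) g x ^+ 2).

Section Multiscale.
Variables (R : realType) (I : finType).
Variable Q : nat -> {linear fun_on I R -> fun_on I R}.

(* The operators are numbered from 1, so Q 0 is never used. *)
Fixpoint ms_error (i : nat) (g : fun_on I R) : fun_on I R :=
  if i is j.+1 then ms_error j g - Q j.+1 (ms_error j g) else g.

Fixpoint ms_approx (i : nat) (g : fun_on I R) : fun_on I R :=
  if i is j.+1 then ms_approx j g + Q j.+1 (ms_error j g) else 0.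

End Multiscale.

Section RandomElements.
Variables (R : realType) (I : finType) (disp : measure_display).
Variables (Omega : measurableType disp) (P : probability Omega R).

(* On the finite-dimensional space R^I, measurability, integrability and
   expectation are coordinatewise. *)
Definition random_element (V : Omega -> fun_on I R) : Prop :=
  forall x : I, measurable_fun [set: Omega] (fun w => V w x : R).

Definition integrable_element (V : Omega -> fun_on I R) : Prop :=
  forall x : I, P.-integrable [set: Omega] (fun w => (V w x : R)%:E).

(* Meaningful when V is integrable: fine maps infinite values to 0. *)
Definition mean (V : Omega -> fun_on I R) : fun_on I R :=
  [ffun x => fine ('E_P[(fun w => V w x : R)])%E].

End RandomElements.

(* Main.v *)
From HB Require Import structures.
Require Import Defs.

(** The expectation is a linear functional on each coordinate and the space of
    functions on a finite set is finite dimensional, so the coordinatewise mean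
    commutes with every linear map between such spaces ([mean_linear]). The
    multiscale approximation operator $M_n$ is such a map, hence a centered
    noise disappears in the mean:
    $E[M_n (f + eps)] = M_n f + M_n (E[eps]) = M_n f$ ([mean_noisy_linear]).
    The recursion gives $M_n + E_n = I$ ([ms_approxDerror]), so the bias
    $f - E[M_n (f + eps)]$ is exactly the multiscale error $E_n f$. Iterating
    the one-level decay estimates from $E_0 f = f$ bounds its norm by the
    product of the $eta_i$ times the norm of $f$ ([le_prod_iter]). *)

Set Implicit Arguments.
Unset Strict Implicit.
Unset Printing Implicit Defensive.

Import Order.TTheory GRing.Theory Num.Theory.

Local Open Scope ring_scope.

Section MultiscaleLinear.
Variables (R : realType) (I : finType).
Variable Q : nat -> {linear fun_on I R -> fun_on I R}.

Lemma ms_error_is_linear i : linear (ms_error Q i).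
Proof.
elim: i => [|i IHi] a g h //=.
by rewrite IHi linearP scalerBr opprD addrACA.
Qed.

HB.instance Definition _ i :=
  GRing.isLinear.Build R (fun_on I R) (fun_on I R) *:%R (ms_error Q i)
    (ms_error_is_linear i).

(** $M_i + E_i = I$: each level moves the term $Q_i E_{i-1} g$ from the error
    to the approximation. *)
Lemma ms_approxDerror i g : ms_approx Q i g + ms_error Q i g = g.
Proof.
elim: i => [|i IHi] /=; first exact: add0r.
by rewrite addrA addrAC addrK.
Qed.

Lemma ms_approxE i g : ms_approx Q i g = g - ms_error Q i g.
Proof. by rewrite -{2}(ms_approxDerror i g) addrK. Qed.

Lemma ms_approx_is_linear i : linear (ms_approx Q i).
Proof.
by move=> a g h; rewrite !ms_approxE linearP scalerBr opprD addrACA.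
Qed.

HB.instance Definition _ i :=
  GRing.isLinear.Build R (fun_on I R) (fun_on I R) *:%R (ms_approx Q i)
    (ms_approx_is_linear i).

End MultiscaleLinear.

Section Mean.
Variables (R : realType) (disp : measure_display).
Variables (Omega : measurableType disp) (P : probability Omega R).

(** Matrix form of a linear map: its entries are its values at the indicator
    functions of single points. *)
Lemma linear_ffunE (I J : finType) (L : {linear fun_on I R -> fun_on J R})
    (g : fun_on I R) (y : J) :
  L g y = \sum_(x : I) L [ffun z => (z == x)%:R] y * g x.
Proof.
have {1}-> : g = \sum_(x : I) g x *: ([ffun z => (z == x)%:R] : fun_on I R).
  apply/ffunP => z; rewrite sum_ffunE (bigD1 z) //= big1 => [|x xz].
    by rewrite !ffunE eqxx addr0 /GRing.scale /= mulr1.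
  by rewrite !ffunE eq_sym (negbTE xz) scaler0.
rewrite linear_sum sum_ffunE; apply: eq_bigr => x _.
by rewrite linearZ !ffunE mulrC.
Qed.

Lemma meanE (I : finType) (V : Omega -> fun_on I R) (x : I) :
  mean P V x = fine (\int[P]_w (V w x)%:E)%E.
Proof. by rewrite ffunE unlock. Qed.

Lemma mean_linear (I J : finType) (L : {linear fun_on I R -> fun_on J R})
    (V : Omega -> fun_on I R) :
  integrable_element P V -> mean P (fun w => L (V w)) = L (mean P V).
Proof.
move=> intV; apply/ffunP => y; rewrite linear_ffunE meanE.
pose c x : R := L [ffun z => (z == x)%:R] y.
under eq_integral => w _ do rewrite linear_ffunE -sumEFin.
have intcV x : P.-integrable [set: Omega] (fun w => ((c x)%:E * (V w x)%:E)%E).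
  by apply: integrableZl => //; exact: intV.
under eq_integral => w _ do under eq_bigr => x _ do rewrite EFinM -/(c x).
rewrite integral_sum // -sum_fine => [|x _]; last exact: integrable_fin_num.
apply: eq_bigr => x _; rewrite meanE (integralZl _ (intV x)) //.
by rewrite fineM //; exact: (integrable_fin_num _ (intV x)).
Qed.

Lemma mean_shift (I : finType) (g : fun_on I R) (V : Omega -> fun_on I R) :
  integrable_element P V -> mean P (fun w => g + V w) = g + mean P V.
Proof.
move=> intV; apply/ffunP => x; rewrite meanE ffunE meanE.
have intg : P.-integrable [set: Omega] (EFin \o cst (g x : R)).
  exact: finite_measure_integrable_cst.
under eq_integral => w _ do rewrite ffunE EFinD.
rewrite (integralD _ intg (intV x)) //= integral_cst //= probability_setT mule1.
by rewrite fineD //; exact: (integrable_fin_num _ (intV x)).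
Qed.

(** A linear estimator applied to data with centered noise is unbiased for the
    value of the estimator at the noiseless data. *)
Lemma mean_noisy_linear (I J : finType) (L : {linear fun_on I R -> fun_on J R})
    (f : fun_on I R) (eps : Omega -> fun_on I R) :
  integrable_element P eps -> mean P eps = 0 ->
  mean P (fun w => L (f + eps w)) = L f.
Proof.
move=> int_eps eps0.
rewrite mean_linear; first by rewrite mean_shift // eps0 addr0.
move=> x; under eq_fun do rewrite ffunE EFinD.
have intf : P.-integrable [set: Omega] (EFin \o cst (f x : R)).
  exact: finite_measure_integrable_cst.
exact: (integrableD _ intf (int_eps x)).
Qed.

End Mean.

(** Nonnegativity of the factors is what lets the induction hypothesis be
    multiplied by the next one. *)
Lemma le_prod_iter (R : realDomainType) (u eta : nat -> R) (n : nat) :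
  (forall i, (1 <= i <= n)%N -> 0 <= eta i) ->
  (forall i, (1 <= i <= n)%N -> u i <= eta i * u i.-1) ->
  u n <= (\prod_(1 <= i < n.+1) eta i) * u 0%N.
Proof.
elim: n => [|n IHn] eta0 decay; first by rewrite big_geq // mul1r.
rewrite big_nat_recr //= mulrAC mulrC.
apply: (le_trans (decay n.+1 _)); first by rewrite leqnn.
rewrite ler_wpM2l ?eta0 ?leqnn //.
by apply: IHn => i /andP[i1 ile]; [apply: eta0|apply: decay]; rewrite i1 leqW.
Qed.

Theorem corollary3p5 (R : realType) (d : nat) (X : {fset 'rV[R]_d}) (n : nat)
  (Q : nat -> {linear fun_on X R -> fun_on X R})
  (disp : measure_display) (Omega : measurableType disp)
  (P : probability Omega R)
  (f : fun_on X R) (eps : Omega -> fun_on X R)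
  (eps_random : random_element eps)
  (eps_integrable : integrable_element P eps)
  (eps_centered : mean P eps = 0)
  (eta : nat -> R)
  (eta_ge0 : forall i : nat, (1 <= i <= n)%N -> 0 <= eta i)
  (error_decay : forall i : nat, (1 <= i <= n)%N ->
     euclid_norm (ms_error Q i f) <= eta i * euclid_norm (ms_error Q i.-1 f)) :
  euclid_norm (f - mean P (fun w => ms_approx Q n (f + eps w)))
    <= (\prod_(1 <= i < n.+1) eta i) * euclid_norm f.
Proof.
have -> : f - mean P (fun w => ms_approx Q n (f + eps w)) = ms_error Q n f.
  rewrite (mean_noisy_linear (ms_approx Q n)) //=.
  by rewrite ms_approxE opprB addrC subrK.
exact: (le_prod_iter (u := fun i => euclid_norm (ms_error Q i f))).
Qed.
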